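(* Let $R$ be a sentence of PA (which exists by the diagonal theorem) such that $$\mathrm{PA}\vdash R\leftrightarrow\forall(\mathbf{x}_1,\{\mathbf{x}_u\})\Bigl(d_U(\overline{\#R},\mathbf{x}_1,\{\mathbf{x}_u\})\rightarrow\exists(\mathbf{x}_2,\{\mathbf{x}_v\})\bigl(\mathbf{x}_2+\{\mathbf{x}_v\}\le\mathbf{x}_1+\{\mathbf{x}_u\}\wedge d_V(\overline{\#R},\mathbf{x}_2,\{\mathbf{x}_v\})\bigr)\Bigr),$$ where $\mathbf{x}_1+\{\mathbf{x}_u\}$ and $\mathbf{x}_2+\{\mathbf{x}_v\}$ abbreviate $\mathbf{x}_1+\sum\mathbf{x}_u$ and $\mathbf{x}_2+\sum\mathbf{x}_v$ (sums over all variables in the tuple). If PA is consistent, then neither $R$ nor $\neg R$ is provable in PA.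
   Context: PA is first-order Peano Arithmetic in the language with $0$, successor $'$, $+$, $\times$, $=$; $s\le t$ is the usual definable order of PA. A standard effective Gödel coding of formulas and proofs of PA by natural numbers is fixed; $\#F$ denotes the Gödel code of $F$. $\mathbb{N}=\{0,1,2,\dots\}$; solutions of Diophantine equations are always sought in $\mathbb{N}$. For $n\in\mathbb{N}$, $\overline{n}$ is the numeral $0''\cdots{}'$ ($n$ successors). $\{x_w\}$, $\{x_u\}$, etc. abbreviate finite tuples of variables (different tuples in one formula consist of different variables), and $\forall(\dots)$, $\exists(\dots)$ blocks of quantifiers; boldface variables are formal variables of PA. Representational formula: given a polynomial $D$ with integer coefficients, rewrite $D=0$ as $D_L=D_R$, where $D_L,D_R$ are polynomials with natural-number coefficients; replace each variable or parameter by a formal variable of PA, each power by a repeated product, and each natural-number constant by its numeral. The resulting formula $d_L=d_R$ of PA is the representational formula of $D=0$. By the MRDP theorem one fixes the following polynomials with integer coefficients. $D_{PE}(y,x_0,\{x_w\})$: for every formula $F$ of PA and every $a\in\mathbb{N}$, $a$ is the Gödel code of a proof of $F$ in PA iff $D_{PE}(\#F,a,\{x_w\})=0$ has a solution $\{x_w\}$ in $\mathbb{N}$. $D_{FC}(a,\{x_{w1}\})$: for all $a\in\mathbb{N}$, $D_{FC}(a,\{x_{w1}\})=0$ has a solution in $\mathbb{N}$ iff $a$ is the Gödel code of a formula of PA. $D_{Neg}(a,b,\{x_{w3}\})$: for all $a,b\in\mathbb{N}$, $D_{Neg}(a,b,\{x_{w3}\})=0$ has a solution in $\mathbb{N}$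 iff $a$ is the Gödel code of a formula $A$ and $b$ is the Gödel code of $\neg A$. Put $$D_U(a,b,\{x_u\})=(D_{FC}(a,\{x_{w1}\}))^2+(D_{PE}(a,b,\{x_w\}))^2,$$ $$D_V(a,b,\{x_v\})=(D_{FC}(a,\{x_{w1}\}))^2+(D_{Neg}(a,x_0,\{x_{w3}\}))^2+(D_{PE}(x_0,b,\{x_w\}))^2,$$ where $\{x_u\}$ consists of $\{x_{w1}\},\{x_w\}$ and $\{x_v\}$ consists of $\{x_{w1}\},x_0,\{x_{w3}\},\{x_w\}$. Thus $D_U(a,b,\{x_u\})=0$ (resp. $D_V(a,b,\{x_v\})=0$) has a solution in $\mathbb{N}$ iff $a$ is the code of a formula $A$ and $b$ is the code of a proof in PA of $A$ (resp. of $\neg A$). $d_U$ and $d_V$ are the representational formulas of $D_U=0$ and $D_V=0$. *)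

(* Defs.v *)
From mathcomp Require Import all_boot all_order all_algebra.
From mathcomp Require Export mpoly.
From Stdlib Require List Cantor.

Set Implicit Arguments.
Unset Strict Implicit.
Unset Printing Implicit Defensive.

Import GRing.Theory.

(* Bound variables are de Bruijn indices: [Var 0] is bound by the innermost
   enclosing [All].  Conjunction, existence and equivalence are the usual
   classical abbreviations over negation, implication, universal quantifier. *)

Inductive term : Type :=
| Var of nat
| Zero
| Succ of term
| Add of term & term
| Mul of term & term.

Inductive formula : Type :=
| Eq of term & term
| Neg of formula
| Imp of formula & formula
| All of formula.

Definition And (A B : formula) : formula := Neg (Imp A (Neg B)).
Definition Iff (A B : formula) : formula := And (Imp A B) (Imp B A).
Definition Ex (A : formula) : formula := Neg (All (Neg A)).

Definition Alls (k : nat) (A : formula) : formula := iter k All A.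
Definition Exs (k : nat) (A : formula) : formula := iter k Ex A.

Definition numeral (n : nat) : term := iter n Succ Zero.

Fixpoint subst_term (s : nat -> term) (t : term) : term :=
  match t with
  | Var n => s n
  | Zero => Zero
  | Succ t1 => Succ (subst_term s t1)
  | Add t1 t2 => Add (subst_term s t1) (subst_term s t2)
  | Mul t1 t2 => Mul (subst_term s t1) (subst_term s t2)
  end.

Definition shift_term : term -> term := subst_term (fun n => Var n.+1).

Definition up (s : nat -> term) (n : nat) : term :=
  if n is m.+1 then shift_term (s m) else Var 0.

Fixpoint subst_form (s : nat -> term) (A : formula) : formula :=
  match A with
  | Eq t1 t2 => Eq (subst_term s t1) (subst_term s t2)
  | Neg B => Neg (subst_form s B)
  | Imp B C => Imp (subst_form s B) (subst_form s C)
  | All B => All (subst_form (up s) B)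
  end.

Definition shift_form : formula -> formula := subst_form (fun n => Var n.+1).

(* [inst A t] eliminates variable 0: it becomes [t], and the other free
   variables are renumbered from [Var n.+1] to [Var n]. *)
Definition inst (A : formula) (t : term) : formula :=
  subst_form (fun n => if n is m.+1 then Var m else t) A.

(* Unlike [inst], keeps variable 0 free: A(x) becomes A(x'). *)
Definition inst_succ (A : formula) : formula :=
  subst_form (fun n => if n is m.+1 then Var m.+1 else Succ (Var 0)) A.

Fixpoint term_below (k : nat) (t : term) : bool :=
  match t with
  | Var n => n < k
  | Zero => true
  | Succ t1 => term_below k t1
  | Add t1 t2 | Mul t1 t2 => term_below k t1 && term_below k t2
  end.

Fixpoint form_below (k : nat) (A : formula) : bool :=
  match A with
  | Eq t1 t2 => term_below k t1 && term_below k t2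
  | Neg B => form_below k B
  | Imp B C => form_below k B && form_below k C
  | All B => form_below k.+1 B
  end.

Definition sentence (A : formula) : bool := form_below 0 A.

Definition Le (s t : term) : formula :=
  Ex (Eq (Add (Var 0) (shift_term s)) (shift_term t)).

Inductive PA_axiom : formula -> Prop :=
| ax_K A B : PA_axiom (Imp A (Imp B A))
| ax_S A B C :
    PA_axiom (Imp (Imp A (Imp B C)) (Imp (Imp A B) (Imp A C)))
| ax_contra A B : PA_axiom (Imp (Imp (Neg B) (Neg A)) (Imp (Imp (Neg B) A) B))
| ax_all_elim A t : PA_axiom (Imp (All A) (inst A t))
| ax_all_imp A B :
    PA_axiom (Imp (All (Imp (shift_form A) B)) (Imp A (All B)))
| ax_eq_refl t : PA_axiom (Eq t t)
| ax_eq_subst A s t : PA_axiom (Imp (Eq s t) (Imp (inst A s) (inst A t)))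
| ax_succ_neq0 : PA_axiom (All (Neg (Eq Zero (Succ (Var 0)))))
| ax_succ_inj :
    PA_axiom (All (All (Imp (Eq (Succ (Var 0)) (Succ (Var 1)))
                            (Eq (Var 0) (Var 1)))))
| ax_add0 : PA_axiom (All (Eq (Add (Var 0) Zero) (Var 0)))
| ax_addS :
    PA_axiom (All (All (Eq (Add (Var 0) (Succ (Var 1)))
                           (Succ (Add (Var 0) (Var 1))))))
| ax_mul0 : PA_axiom (All (Eq (Mul (Var 0) Zero) Zero))
| ax_mulS :
    PA_axiom (All (All (Eq (Mul (Var 0) (Succ (Var 1)))
                           (Add (Mul (Var 0) (Var 1)) (Var 0)))))
| ax_induction A :
    PA_axiom (Imp (inst A Zero) (Imp (All (Imp A (inst_succ A))) (All A))).

(* The rules are modus ponens and generalization. *)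
Definition justified (prev : seq formula) (A : formula) : Prop :=
  [\/ PA_axiom A,
      exists B, List.In B prev /\ List.In (Imp B A) prev
    | exists B, List.In B prev /\ A = All B].

Definition derivation (p : seq formula) : Prop :=
  forall q A r, p = q ++ A :: r -> justified q A.

Definition proof_of (p : seq formula) (A : formula) : Prop :=
  derivation p /\ exists q, p = rcons q A.

Definition provable (A : formula) : Prop := exists p, proof_of p A.

Definition PA_consistent : Prop :=
  ~ exists A, provable A /\ provable (Neg A).

Definition cpair (m n : nat) : nat := Cantor.to_nat (m, n).

Fixpoint code_term (t : term) : nat :=
  match t with
  | Var n => cpair 0 n
  | Zero => cpair 1 0
  | Succ t1 => cpair 2 (code_term t1)
  | Add t1 t2 => cpair 3 (cpair (code_term t1) (code_term t2))
  | Mul t1 t2 => cpair 4 (cpair (code_term t1) (code_term t2))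
  end.

Fixpoint code_form (A : formula) : nat :=
  match A with
  | Eq t1 t2 => cpair 0 (cpair (code_term t1) (code_term t2))
  | Neg B => cpair 1 (code_form B)
  | Imp B C => cpair 2 (cpair (code_form B) (code_form C))
  | All B => cpair 3 (code_form B)
  end.

Fixpoint code_proof (p : seq formula) : nat :=
  if p is A :: q then (cpair (code_form A) (code_proof q)).+1 else 0.

Local Open Scope ring_scope.

Definition zero_at n (D : {mpoly int[n]}) (v : n.-tuple nat) : Prop :=
  D.@[fun i => (tnth v i)%:Z] = 0.

Definition expresses_proof nw (D_PE : {mpoly int[nw.+2]}) : Prop :=
  forall (F : formula) (a : nat),
    (exists p, proof_of p F /\ a = code_proof p) <->
    (exists w : nw.-tuple nat, zero_at D_PE [tuple of code_form F :: a :: w]).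

Definition expresses_formula_code nw1 (D_FC : {mpoly int[nw1.+1]}) : Prop :=
  forall a : nat,
    (exists w1 : nw1.-tuple nat, zero_at D_FC [tuple of a :: w1]) <->
    (exists A, a = code_form A).

Definition expresses_negation nw3 (D_Neg : {mpoly int[nw3.+2]}) : Prop :=
  forall a b : nat,
    (exists w3 : nw3.-tuple nat, zero_at D_Neg [tuple of a :: b :: w3]) <->
    (exists A, a = code_form A /\ b = code_form (Neg A)).

Definition len_u (nw nw1 : nat) : nat := (nw1 + nw)%N.
Definition len_v (nw nw1 nw3 : nat) : nat := (nw1 + (nw3 + nw).+1)%N.

(* [xvars n o k] is the block of k variables of index o, ..., o + k - 1. *)
Definition xvars n (o k : nat) : k.-tuple {mpoly int[n.+1]} :=
  [tuple 'X_(inord (o + i)) | i < k].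

(* Variable order: a, b, x_w1, x_w. *)
Definition D_U nw nw1 (D_FC : {mpoly int[nw1.+1]}) (D_PE : {mpoly int[nw.+2]}) :
    {mpoly int[(len_u nw nw1).+2]} :=
  let a := 'X_(inord 0) in
  let b := 'X_(inord 1) in
  let w1 := xvars _ 2 nw1 in
  let w := xvars _ (2 + nw1) nw in
  (D_FC \mPo [tuple of a :: w1]) ^+ 2 + (D_PE \mPo [tuple of a :: b :: w]) ^+ 2.

(* Variable order: a, b, x_w1, x_0, x_w3, x_w. *)
Definition D_V nw nw1 nw3 (D_FC : {mpoly int[nw1.+1]})
    (D_Neg : {mpoly int[nw3.+2]}) (D_PE : {mpoly int[nw.+2]}) :
    {mpoly int[(len_v nw nw1 nw3).+2]} :=
  let a := 'X_(inord 0) in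
  let b := 'X_(inord 1) in
  let w1 := xvars _ 2 nw1 in
  let x0 := 'X_(inord (2 + nw1)) in
  let w3 := xvars _ (3 + nw1) nw3 in
  let w := xvars _ (3 + nw1 + nw3) nw in
  (D_FC \mPo [tuple of a :: w1]) ^+ 2
  + (D_Neg \mPo [tuple of a :: x0 :: w3]) ^+ 2
  + (D_PE \mPo [tuple of x0 :: b :: w]) ^+ 2.

(* A polynomial with natural-number coefficients as it is written down; the
   representational formula depends on the written expression. *)
Inductive nexp (n : nat) : Type :=
| NVar of 'I_n
| NConst of nat
| NAdd of nexp n & nexp n
| NMul of nexp n & nexp n
| NPow of nexp n & nat.

Fixpoint nexp_poly n (e : nexp n) : {mpoly int[n]} :=
  match e with
  | NVar i => 'X_i
  | NConst c => c%:R
  | NAdd e1 e2 => nexp_poly e1 + nexp_poly e2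
  | NMul e1 e2 => nexp_poly e1 * nexp_poly e2
  | NPow e1 k => nexp_poly e1 ^+ k
  end.

Definition pow_term (t : term) (k : nat) : term :=
  if k is m.+1 then iter m (fun u => Mul u t) t else numeral 1.

Fixpoint nexp_term n (e : nexp n) : term :=
  match e with
  | NVar i => Var i
  | NConst c => numeral c
  | NAdd e1 e2 => Add (nexp_term e1) (nexp_term e2)
  | NMul e1 e2 => Mul (nexp_term e1) (nexp_term e2)
  | NPow e1 k => pow_term (nexp_term e1) k
  end.

(* The splitting of D = 0 into D_L = D_R is not unique, so this is a relation;
   the i-th variable of D becomes the formal variable [Var i]. *)
Definition representational n (D : {mpoly int[n]}) (d : formula) : Prop :=
  exists D_L D_R : nexp n,
    D = nexp_poly D_L - nexp_poly D_R /\ d = Eq (nexp_term D_L) (nexp_term D_R).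

(* The sum of Var o, Var o.+1, ..., Var (o + k), i.e. x + {y} for a variable x
   followed by a tuple {y} of length k. *)
Definition sum_vars (o k : nat) : term :=
  foldl (fun t i => Add t (Var i)) (Var o) (iota o.+1 k).

(* In [inst d_U c] and [inst d_V c] the first parameter is replaced by c, so
   that x_1, {x_u} (resp. x_2, {x_v}) are variables 0, ..., nu (resp. nv), each
   block being quantified with its first variable innermost.  Under the
   existential block, x_1, {x_u} are variables nv.+1, ..., nv.+1 + nu. *)
Definition rosser_body (nu nv : nat) (d_U d_V : formula) (c : term) : formula :=
  Alls nu.+1
    (Imp (inst d_U c)
       (Exs nv.+1
          (And (Le (sum_vars 0 nv) (sum_vars nv.+1 nu)) (inst d_V c)))).

(* Main.v *)
(* Every quantified variable is bounded by the sum of its block, so below a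
   numeral the representational formulas are decided case by case in PA.
   If R has a proof, with code and witnesses of sum N, then PA proves the
   instance of d_U, hence that some solution of d_V has sum at most N; by
   consistency no tuple of numbers solves D_V, so PA refutes this. If ~R has a
   proof, with code and witnesses of sum M, then PA proves the right-hand side
   of the fixed point: tuples of sum at most M do not satisfy d_U, again by
   consistency, and for the others the solution of D_V is the wanted witness. *)

Require Import Defs.
From mathcomp Require Import all_boot all_order all_algebra.
From mathcomp Require Import zify.

Set Implicit Arguments.
Unset Strict Implicit.
Unset Printing Implicit Defensive.

Import Order.TTheory GRing.Theory Num.Theory.

(** * Substitution *)

(** Convertible to the substitutions inside [inst] and [inst_succ], so that [instE] and [inst_succE]
    hold by computation. *)
Definition scons (t : term) (s : nat -> term) (n : nat) : term :=
  if n is m.+1 then s m else t.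

(** Fills a whole quantifier block at once: variables beyond the block are lowered by [size ts]. *)
Definition msubst (ts : seq term) : nat -> term := foldr scons Var ts.

Lemma eq_subst_term s1 s2 t :
  (forall n, s1 n = s2 n) -> subst_term s1 t = subst_term s2 t.
Proof.
move=> e; elim: t => //= [t ->|t1 -> t2 ->|t1 -> t2 ->] //.
Qed.

Lemma subst_termA s1 s2 t :
  subst_term s1 (subst_term s2 t) = subst_term (fun n => subst_term s1 (s2 n)) t.
Proof. by elim: t => //= [t ->|t1 -> t2 ->|t1 -> t2 ->]. Qed.

Lemma subst_term_Var t : subst_term Var t = t.
Proof. by elim: t => //= [t ->|t1 -> t2 ->|t1 -> t2 ->]. Qed.

Lemma subst_scons_shift t u s : subst_term (scons t s) (shift_term u) = subst_term s u.
Proof. by rewrite subst_termA. Qed.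

Lemma inst_shift_term t u : subst_term (scons t Var) (shift_term u) = u.
Proof. by rewrite subst_scons_shift subst_term_Var. Qed.

Lemma subst_up_shift s t : subst_term (up s) (shift_term t) = shift_term (subst_term s t).
Proof. by rewrite /shift_term !subst_termA. Qed.

(** Parameters of an induction formula are shifted past the induction variable; this law carries
    them unchanged through [inst_succ]. *)
Lemma shift_succ t :
  subst_term (scons (Succ (Var 0)) (fun n => Var n.+1)) (shift_term t) = shift_term t.
Proof. by rewrite subst_scons_shift. Qed.

Lemma eq_subst_form s1 s2 A :
  (forall n, s1 n = s2 n) -> subst_form s1 A = subst_form s2 A.
Proof.
elim: A s1 s2 => //= [t1 t2|A IH|A IHA B IHB|A IH] s1 s2 e.
- by rewrite !(eq_subst_term _ e).
- by rewrite (IH _ _ e).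
- by rewrite (IHA _ _ e) (IHB _ _ e).
- by congr All; apply: IH => -[|n] //=; rewrite e.
Qed.

Lemma subst_formA s1 s2 A :
  subst_form s1 (subst_form s2 A) = subst_form (fun n => subst_term s1 (s2 n)) A.
Proof.
elim: A s1 s2 => //= [t1 t2|A IH|A IHA B IHB|A IH] s1 s2.
- by rewrite !subst_termA.
- by rewrite IH.
- by rewrite IHA IHB.
- by congr All; rewrite IH; apply: eq_subst_form => -[|n] //=; rewrite subst_up_shift.
Qed.

Lemma subst_form_Var A : subst_form Var A = A.
Proof.
elim: A => //= [t1 t2|A ->|A -> B ->|A eA] //; first by rewrite !subst_term_Var.
by congr All; rewrite -[RHS]eA; apply: eq_subst_form => -[].
Qed.

Lemma instE A t : inst A t = subst_form (scons t Var) A.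
Proof. by []. Qed.

Lemma inst_succE A :
  inst_succ A = subst_form (scons (Succ (Var 0)) (fun n => Var n.+1)) A.
Proof. by []. Qed.

(** The key to quantifier blocks: the innermost variable can be filled last, and the result is again
    one simultaneous substitution, as in [msubst]. *)
Lemma inst_subst_up s A t : inst (subst_form (up s) A) t = subst_form (scons t s) A.
Proof.
by rewrite instE subst_formA; apply: eq_subst_form => -[|n] //=; rewrite inst_shift_term.
Qed.

Lemma subst_Le s t u : subst_form s (Le t u) = Le (subst_term s t) (subst_term s u).
Proof. by rewrite /Le /= !subst_up_shift. Qed.

Lemma shift_Le t u : shift_form (Le t u) = Le (shift_term t) (shift_term u).
Proof. exact: subst_Le. Qed.

Lemma subst_numeral s n : subst_term s (numeral n) = numeral n.
Proof. by elim: n => //= n ->. Qed.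

Lemma shift_numeral n : shift_term (numeral n) = numeral n.
Proof. exact: subst_numeral. Qed.

Lemma iter_shift_numeral k n : iter k shift_term (numeral n) = numeral n.
Proof. by elim: k => //= k ->; rewrite shift_numeral. Qed.

Lemma subst_term_below k s t :
  (forall i, i < k -> s i = Var i) -> term_below k t -> subst_term s t = t.
Proof.
move=> sV; elim: t => //= [t IH /IH->|t1 IH1 t2 IH2|t1 IH1 t2 IH2] //.
  by case/andP=> /IH1-> /IH2->.
by case/andP=> /IH1-> /IH2->.
Qed.

Lemma subst_Exs k s A : subst_form s (Exs k A) = Exs k (subst_form (iter k up s) A).
Proof. by elim: k s => //= k IH s; rewrite /Ex IH -iterSr. Qed.

Lemma iter_up_lt k s i : i < k -> iter k up s i = Var i.
Proof. by elim: k i => // k IH [|i] //= lt_ik; rewrite IH. Qed.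

Lemma iter_up_ge k s i : iter k up s (k + i) = iter k shift_term (s i).
Proof. by elim: k => //= k ->. Qed.

Lemma msubst_lt ts i : i < size ts -> msubst ts i = nth Zero ts i.
Proof. by elim: ts i => // t ts IH [|i] //= /IH. Qed.

Lemma msubst_ge ts i : msubst ts (size ts + i) = Var i.
Proof. by elim: ts => //=. Qed.

Lemma sum_varsS o k : sum_vars o k.+1 = Add (sum_vars o k) (Var (o + k.+1)).
Proof. by rewrite /sum_vars -[in iota _ k.+1](addn1 k) iotaD foldl_cat /= addSnnS. Qed.

(** Moves a block at any offset to offset 0, where [sum_vars_below] makes its sum available to
    evaluation. *)
Lemma subst_sum_vars s o k :
  subst_term s (sum_vars o k) = subst_term (fun i => s (o + i)) (sum_vars 0 k).
Proof.
elim: k => [|k IH]; first by rewrite /= addn0.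
by rewrite !sum_varsS /= IH add0n.
Qed.

Lemma sum_vars_below k : term_below k.+1 (sum_vars 0 k).
Proof.
have mono t n m : n <= m -> term_below n t -> term_below m t.
  move=> le_nm; elim: t => //= [i|t1 IH1 t2 IH2|t1 IH1 t2 IH2].
  - by move=> /leq_trans ->.
  - by case/andP=> /IH1-> /IH2->.
  - by case/andP=> /IH1-> /IH2->.
elim: k => // k IH; rewrite sum_varsS /= add0n ltnS leqnn andbT.
by apply: mono IH.
Qed.

(** * Natural deduction *)

Lemma derivation_rcons p A : derivation p -> justified p A -> derivation (rcons p A).
Proof.
move=> dp jA q B r; case/lastP: r => [|r C].
  by rewrite cats1 => /rcons_inj [<- <-].
by rewrite -rcons_cons -rcons_cat => /rcons_inj [/dp ? _].
Qed.

Lemma justified_incl p q A :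
  (forall B, List.In B p -> List.In B q) -> justified p A -> justified q A.
Proof.
move=> pq [ax|[B [pB pBA]]|[B [pB ->]]].
- exact: Or31.
- by apply: Or32; exists B; split; apply: pq.
- by apply: Or33; exists B; split=> //; apply: pq.
Qed.

(** The lines of [q] are appended one by one; each stays justified because [justified] is monotone
    in the earlier lines. *)
Lemma derivation_cat p q : derivation p -> derivation q -> derivation (p ++ q).
Proof.
move=> dp; elim/last_ind: q => [|q A IH] dq; first by rewrite cats0.
rewrite -rcons_cat; apply: derivation_rcons.
  apply: IH => q1 B r e; apply: (dq _ _ (rcons r A)).
  by rewrite e rcons_cat.
apply: justified_incl (dq q A [::] _); last by rewrite cats1.
by move=> B qB; apply/List.in_or_app; right.
Qed.

Lemma provable_axiom A : PA_axiom A -> provable A.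
Proof.
move=> ax; exists [:: A]; split; last by exists [::].
by apply: (@derivation_rcons [::]); [case | apply: Or31].
Qed.

Lemma in_rcons p (A : formula) : List.In A (rcons p A).
Proof. by rewrite -cats1; apply/List.in_or_app; right; left. Qed.

Lemma provable_mp A B : provable (Imp A B) -> provable A -> provable B.
Proof.
move=> [p [dp [p' ep]]] [q [dq [q' eq]]].
exists (rcons (p ++ q) B); split; last by exists (p ++ q).
apply: derivation_rcons; first exact: derivation_cat.
apply: Or32; exists A; split; apply/List.in_or_app.
  by right; rewrite eq; apply: in_rcons.
by left; rewrite ep; apply: in_rcons.
Qed.

Lemma provable_gen A : provable A -> provable (All A).
Proof.
move=> [p [dp [q ep]]]; exists (rcons p (All A)); split; last by exists p.
apply: derivation_rcons => //; apply: Or33; exists A; split=> //.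
by rewrite ep; apply: in_rcons.
Qed.

(* Folding from the left makes [H :: G |-- A] convertible to [G |-- Imp H A]. *)
Definition entails (G : seq formula) (A : formula) : Prop :=
  provable (foldl (fun B H => Imp H B) A G).

Notation "G |-- A" := (entails G A) (at level 70, no associativity).

Lemma entails_impI G A B : A :: G |-- B -> G |-- Imp A B.
Proof. by []. Qed.

Lemma entails_provable G A : provable A -> G |-- A.
Proof.
elim: G A => //= H G IH A pA; apply: (IH (Imp H A)).
apply: (provable_mp _ pA); exact/provable_axiom/ax_K.
Qed.

Lemma entails_axiom G A : PA_axiom A -> G |-- A.
Proof. by move=> ax; apply/entails_provable/provable_axiom. Qed.

(** Axiom S distributes each hypothesis of the context over the implication. As discharging a
    hypothesis is mere conversion, this plays the part of the deduction theorem. *)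
Lemma entails_mp G A B : G |-- Imp A B -> G |-- A -> G |-- B.
Proof.
elim: G A B => [|H G IH] A B; first exact: provable_mp.
move=> pAB pA; apply: (IH (Imp H A) (Imp H B)) pA.
by apply: IH pAB; apply/entails_axiom/ax_S.
Qed.

Lemma entails_weaken H G A : G |-- A -> H :: G |-- A.
Proof. by move=> pA; apply: (@entails_mp G A (Imp H A)) pA; apply/entails_axiom/ax_K. Qed.

(** The usual derivation of A -> A from S, K and K. *)
Lemma entails_hyp G A : A :: G |-- A.
Proof.
apply: (@entails_mp G (Imp A (Imp A A)) (Imp A A)); last exact/entails_axiom/ax_K.
apply: (@entails_mp G (Imp A (Imp (Imp A A) A))); last exact/entails_axiom/ax_K.
exact/entails_axiom/ax_S.
Qed.

Ltac hyp := solve [exact: entails_hyp | apply: entails_weaken; hyp].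

Lemma entails_contra G A B : Neg B :: G |-- A -> Neg B :: G |-- Neg A -> G |-- B.
Proof.
move=> pA pNA; apply: (@entails_mp G (Imp (Neg B) A)) pA.
by apply: (@entails_mp G (Imp (Neg B) (Neg A))) pNA; apply/entails_axiom/ax_contra.
Qed.

Lemma entails_absurd G A B : G |-- A -> G |-- Neg A -> G |-- B.
Proof. by move=> pA pNA; apply: (@entails_contra G A); apply: entails_weaken. Qed.

Lemma entails_cut G A B : G |-- A -> A :: G |-- B -> G |-- B.
Proof. by move=> pA pB; apply: entails_mp pA. Qed.

Lemma entails_negE G A : G |-- Neg (Neg A) -> G |-- A.
Proof. by move=> pA; apply: (@entails_contra G (Neg A)); [hyp | apply: entails_weaken]. Qed.

Lemma entails_negI G A B : A :: G |-- B -> A :: G |-- Neg B -> G |-- Neg A.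
Proof.
move=> pB pNB; apply: (@entails_contra G B).
  apply: (@entails_mp _ A); first by apply: entails_weaken; exact: pB.
  by apply: entails_negE; hyp.
apply: (@entails_mp _ A); first by apply: entails_weaken; exact: pNB.
by apply: entails_negE; hyp.
Qed.

Lemma entails_case G A C : A :: G |-- C -> Neg A :: G |-- C -> G |-- C.
Proof.
move=> pC pC'; apply: (@entails_contra G A); last first.
  apply: (@entails_negI _ _ C); last hyp.
  by apply: (@entails_mp _ A); [do 2!apply: entails_weaken; exact: pC | hyp].
apply: entails_negE; apply: (@entails_negI _ _ C); last hyp.
by apply: (@entails_mp _ (Neg A)); [do 2!apply: entails_weaken; exact: pC' | hyp].
Qed.

Lemma entails_andI G A B : G |-- A -> G |-- B -> G |-- And A B.
Proof.
move=> pA pB; apply: (@entails_negI _ _ B); first exact: entails_weaken.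
by apply: (@entails_mp _ A); [hyp | apply: entails_weaken].
Qed.

Lemma entails_andEr G A B : G |-- And A B -> G |-- B.
Proof.
move=> pAB; apply: (@entails_contra _ (Imp A (Neg B))); last exact: entails_weaken.
by apply: entails_impI; hyp.
Qed.

Lemma entails_andEl G A B : G |-- And A B -> G |-- A.
Proof.
move=> pAB; apply: (@entails_contra _ (Imp A (Neg B))); last exact: entails_weaken.
by apply: entails_impI; apply: (@entails_absurd _ A); hyp.
Qed.

Definition Or (A B : formula) : formula := Imp (Neg A) B.

Lemma entails_orIl G A B : G |-- A -> G |-- Or A B.
Proof. by move=> pA; apply: entails_impI; apply: (@entails_absurd _ A); [apply: entails_weaken | hyp]. Qed.

Lemma entails_orIr G A B : G |-- B -> G |-- Or A B.
Proof. by move=> pB; apply: entails_impI; apply: entails_weaken. Qed.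

Lemma entails_orE G A B C : G |-- Or A B -> A :: G |-- C -> B :: G |-- C -> G |-- C.
Proof.
move=> pAB pA pB; apply: (entails_case pA); apply: (@entails_mp _ B); first exact: entails_weaken.
by apply: (@entails_mp _ (Neg A)); [apply: entails_weaken | hyp].
Qed.

(** Shifting the context expresses the eigenvariable condition: [Var 0] is not free in the
    hypotheses, so [ax_all_imp] moves each of them out of the quantifier. *)
Lemma entails_allI G A : map shift_form G |-- A -> G |-- All A.
Proof.
elim: G A => [|H G IH] A; first exact: provable_gen.
move=> /(IH (Imp (shift_form H) A)) pA.
by apply: (@entails_mp G _ (Imp H (All A))) pA; apply/entails_axiom/ax_all_imp.
Qed.

Lemma entails_allE G A t : G |-- All A -> G |-- inst A t.
Proof. by apply: entails_mp; apply/entails_axiom/ax_all_elim. Qed.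

Lemma entails_exI G A t : G |-- inst A t -> G |-- Ex A.
Proof.
move=> pA; apply: (@entails_negI _ _ (inst A t)); first exact: entails_weaken.
by apply: (@entails_allE _ (Neg A) t); hyp.
Qed.

(** The witness is [Var 0], made fresh by shifting both the context and the conclusion. *)
Lemma entails_exE G A C :
  G |-- Ex A -> A :: map shift_form G |-- shift_form C -> G |-- C.
Proof.
move=> pA pC; apply: (@entails_contra _ (All (Neg A))); last exact: entails_weaken.
apply: entails_allI; apply: (@entails_negI _ _ (shift_form C)); last by rewrite /=; hyp.
by apply: (@entails_mp _ A); [do 2!apply: entails_weaken; exact: pC | hyp].
Qed.

Lemma provable_alls k A : provable A -> provable (Alls k A).
Proof. by move=> pA; elim: k => //= k; apply: provable_gen. Qed.

(** The head of [ts] belongs to the innermost quantifier, which [iterSr] regroups with the matrix;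
    the outer quantifiers are instantiated first. *)
Lemma entails_allsE G ts A : G |-- Alls (size ts) A -> G |-- subst_form (msubst ts) A.
Proof.
elim: ts A => [|t ts IH] A /= pA.
  by rewrite subst_form_Var.
rewrite -inst_subst_up; apply: entails_allE; apply: (IH (All A)).
by rewrite /Alls -iterSr.
Qed.

Lemma entails_exsI G ts A : G |-- subst_form (msubst ts) A -> G |-- Exs (size ts) A.
Proof.
elim: ts A => [|t ts IH] A /= pA.
  by rewrite -(subst_form_Var A).
rewrite -[Ex _]/(Exs (size ts).+1 A) /Exs iterSr; apply: (IH (Ex A)).
by apply: (@entails_exI _ _ t); rewrite inst_subst_up.
Qed.

(** Generalizing the refutation of the matrix contradicts [Ex], a negated universal. A block of
    existential variables may thus be left free while its matrix is refuted. *)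
Lemma provable_neg_exs k A : provable (Neg A) -> provable (Neg (Exs k A)).
Proof.
move=> pA; elim: k => //= k /provable_gen pE.
apply: (@entails_negI [::] _ (All (Neg (Exs k A)))); last exact: entails_hyp.
exact: entails_provable.
Qed.

(** * Equality and arithmetic in PA *)

Lemma pa_refl G t : G |-- Eq t t.
Proof. exact/entails_axiom/ax_eq_refl. Qed.

(** Leibniz's law with [Var 0] as the hole of the template [A]. Its uses choose a template and shift
    the other terms past the hole. *)
Lemma pa_rewrite G A s t : G |-- Eq s t -> G |-- inst A s -> G |-- inst A t.
Proof.
move=> e; apply: entails_mp; apply: entails_mp e.
exact/entails_axiom/ax_eq_subst.
Qed.

Lemma pa_sym G s t : G |-- Eq s t -> G |-- Eq t s.
Proof.
move=> e; have := @pa_rewrite G (Eq (Var 0) (shift_term s)) s t e.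
by rewrite !instE /= !inst_shift_term; apply; apply: pa_refl.
Qed.

Lemma pa_trans G t s u : G |-- Eq s t -> G |-- Eq t u -> G |-- Eq s u.
Proof.
move=> est e; have := @pa_rewrite G (Eq (shift_term s) (Var 0)) t u e.
by rewrite !instE /= !inst_shift_term; apply.
Qed.

Lemma pa_congrS G s t : G |-- Eq s t -> G |-- Eq (Succ s) (Succ t).
Proof.
move=> e; have := @pa_rewrite G (Eq (Succ (shift_term s)) (Succ (Var 0))) s t e.
by rewrite !instE /= !inst_shift_term; apply; apply: pa_refl.
Qed.

Lemma pa_congrD G s s' t t' :
  G |-- Eq s s' -> G |-- Eq t t' -> G |-- Eq (Add s t) (Add s' t').
Proof.
move=> e1 e2; apply: (@pa_trans _ (Add s' t)).
  have := @pa_rewrite G (Eq (shift_term (Add s t)) (Add (Var 0) (shift_term t))) s s' e1.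
  by rewrite !instE /= !inst_shift_term; apply; apply: pa_refl.
have := @pa_rewrite G (Eq (shift_term (Add s' t)) (Add (shift_term s') (Var 0))) t t' e2.
by rewrite !instE /= !inst_shift_term; apply; apply: pa_refl.
Qed.

Lemma pa_congrM G s s' t t' :
  G |-- Eq s s' -> G |-- Eq t t' -> G |-- Eq (Mul s t) (Mul s' t').
Proof.
move=> e1 e2; apply: (@pa_trans _ (Mul s' t)).
  have := @pa_rewrite G (Eq (shift_term (Mul s t)) (Mul (Var 0) (shift_term t))) s s' e1.
  by rewrite !instE /= !inst_shift_term; apply; apply: pa_refl.
have := @pa_rewrite G (Eq (shift_term (Mul s' t)) (Mul (shift_term s') (Var 0))) t t' e2.
by rewrite !instE /= !inst_shift_term; apply; apply: pa_refl.
Qed.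

Lemma pa_succ_neq0 G t : G |-- Neg (Eq Zero (Succ t)).
Proof. exact: (entails_allE t (entails_axiom G ax_succ_neq0)). Qed.

Lemma pa_succ_inj G s t : G |-- Eq (Succ s) (Succ t) -> G |-- Eq s t.
Proof.
(* The outer quantifier binds [Var 1], hence [t] is supplied before [s]. *)
apply: entails_mp; have := entails_allE s (entails_allE t (entails_axiom G ax_succ_inj)).
by rewrite !instE /= !inst_shift_term.
Qed.

Lemma pa_addr0 G t : G |-- Eq (Add t Zero) t.
Proof. exact: (entails_allE t (entails_axiom G ax_add0)). Qed.

Lemma pa_addrS G s t : G |-- Eq (Add s (Succ t)) (Succ (Add s t)).
Proof.
have := entails_allE s (entails_allE t (entails_axiom G ax_addS)).
by rewrite !instE /= !inst_shift_term.
Qed.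

Lemma pa_mulr0 G t : G |-- Eq (Mul t Zero) Zero.
Proof. exact: (entails_allE t (entails_axiom G ax_mul0)). Qed.

Lemma pa_mulrS G s t : G |-- Eq (Mul s (Succ t)) (Add (Mul s t) s).
Proof.
have := entails_allE s (entails_allE t (entails_axiom G ax_mulS)).
by rewrite !instE /= !inst_shift_term.
Qed.

(** Induction as a rule: [Var 0] is the induction variable, fresh for the shifted context of the
    successor step. *)
Lemma pa_induction G A t :
  G |-- inst A Zero -> A :: map shift_form G |-- inst_succ A -> G |-- inst A t.
Proof.
move=> p0 pS; apply: entails_allE; apply: (@entails_mp _ (All (Imp A (inst_succ A)))).
  by apply: entails_mp p0; apply/entails_axiom/ax_induction.
exact: entails_allI.
Qed.

Lemma pa_add0r G t : G |-- Eq (Add Zero t) t.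
Proof.
apply: (@pa_induction G (Eq (Add Zero (Var 0)) (Var 0))); first exact: pa_addr0.
by apply: pa_trans (pa_addrS _ _ _) _; apply: pa_congrS; hyp.
Qed.

Lemma pa_addSr G s t : G |-- Eq (Add (Succ s) t) (Succ (Add s t)).
Proof.
pose A := Eq (Add (Succ (shift_term s)) (Var 0)) (Succ (Add (shift_term s) (Var 0))).
have := @pa_induction G A t.
rewrite inst_succE !instE /= !inst_shift_term !shift_succ; apply.
  by apply: pa_trans (pa_addr0 _ _) _; apply/pa_congrS/pa_sym/pa_addr0.
apply: pa_trans (pa_addrS _ _ _) _; apply: pa_congrS.
by apply: pa_trans (pa_sym (pa_addrS _ _ _)); hyp.
Qed.

Lemma pa_addC G s t : G |-- Eq (Add s t) (Add t s).
Proof.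
have := @pa_induction G (Eq (Add (shift_term s) (Var 0)) (Add (Var 0) (shift_term s))) t.
rewrite inst_succE !instE /= !inst_shift_term !shift_succ; apply.
  by apply: pa_trans (pa_addr0 _ _) _; apply/pa_sym/pa_add0r.
apply: pa_trans (pa_addrS _ _ _) _; apply: pa_trans (pa_sym (pa_addSr _ _ _)).
by apply: pa_congrS; hyp.
Qed.

Lemma pa_addA G s t u : G |-- Eq (Add s (Add t u)) (Add (Add s t) u).
Proof.
pose A := Eq (Add (shift_term s) (Add (shift_term t) (Var 0)))
             (Add (Add (shift_term s) (shift_term t)) (Var 0)).
have := @pa_induction G A u.
rewrite inst_succE !instE /= !inst_shift_term !shift_succ; apply.
  apply: pa_trans (pa_sym (pa_addr0 _ _)).
  by apply: pa_congrD (pa_refl _ _) (pa_addr0 _ _).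
apply: pa_trans (pa_congrD (pa_refl _ _) (pa_addrS _ _ _)) _.
apply: pa_trans (pa_addrS _ _ _) _; apply: pa_trans (pa_sym (pa_addrS _ _ _)).
by apply: pa_congrS; hyp.
Qed.

Lemma zero_or_succ G C t :
  Eq t Zero :: G |-- C ->
  Eq (shift_term t) (Succ (Var 0)) :: map shift_form G |-- shift_form C -> G |-- C.
Proof.
have pt : G |-- Or (Eq t Zero) (Ex (Eq (shift_term t) (Succ (Var 0)))).
  apply: (@pa_induction G (Or (Eq (Var 0) Zero) (Ex (Eq (Var 1) (Succ (Var 0)))))).
    exact/entails_orIl/pa_refl.
  (* In the successor case the induction variable itself is the predecessor. *)
  by apply: entails_orIr; apply: (@entails_exI _ _ (Var 0)); apply: pa_refl.
move=> p0 pS; apply: entails_orE pt p0 _; apply: entails_exE; first exact: entails_hyp.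
apply: (@entails_mp _ (Eq (shift_term t) (Succ (Var 0)))); last hyp.
by do 2!apply: entails_weaken; exact: pS.
Qed.

(** * Order in PA and case analysis below a numeral *)

Lemma le_intro G z s t : G |-- Eq (Add z s) t -> G |-- Le s t.
Proof. by move=> e; apply: (@entails_exI _ _ z); rewrite instE /= !inst_shift_term. Qed.

Lemma le_elim G s t C : G |-- Le s t ->
  Eq (Add (Var 0) (shift_term s)) (shift_term t) :: map shift_form G |-- shift_form C ->
  G |-- C.
Proof. exact: entails_exE. Qed.

Lemma le_eq G s s' t t' :
  G |-- Eq s s' -> G |-- Eq t t' -> G |-- Le s t -> G |-- Le s' t'.
Proof.
move=> e1 e2 l.
have r1 := @pa_rewrite G (Le (Var 0) (shift_term t)) s s' e1.
have r2 := @pa_rewrite G (Le (shift_term s') (Var 0)) t t' e2.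
rewrite !instE !subst_Le /= !inst_shift_term in r1 r2.
exact/r2/r1.
Qed.

(** If z + (s + t) = u, then z + s is a witness for t. *)
Lemma le_addr G s t u : G |-- Le (Add s t) u -> G |-- Le t u.
Proof.
move=> l; apply: (le_elim l); rewrite shift_Le.
apply: (@le_intro _ (Add (Var 0) (shift_term s))).
by apply: pa_trans (pa_sym (pa_addA _ _ _ _)) _; hyp.
Qed.

Lemma le_addl G s t u : G |-- Le (Add s t) u -> G |-- Le s u.
Proof.
move=> l; apply: (@le_addr _ t); apply: le_eq l; [exact: pa_addC | exact: pa_refl].
Qed.

Lemma le_SS G s t : G |-- Le s t -> G |-- Le (Succ s) (Succ t).
Proof.
move=> l; apply: (le_elim l); rewrite shift_Le; apply: (@le_intro _ (Var 0)).
by apply: pa_trans (pa_addrS _ _ _) _; apply: pa_congrS; hyp.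
Qed.

Lemma le_SS_inv G s t : G |-- Le (Succ s) (Succ t) -> G |-- Le s t.
Proof.
move=> l; apply: (le_elim l); rewrite shift_Le; apply: (@le_intro _ (Var 0)).
apply: pa_succ_inj; apply: pa_trans (pa_sym (pa_addrS _ _ _)) _; hyp.
Qed.

Lemma le_0 G t : G |-- Le Zero t.
Proof. exact: (le_intro (pa_addr0 _ _)). Qed.

(** Comparison with a numeral goes by induction on [n] outside PA: [t] is split into zero or a
    successor, whose predecessor is compared with the previous numeral. The split extends the
    context, so [G] varies in the induction. *)
Lemma le_total_numeral n G t : G |-- Or (Le t (numeral n)) (Le (numeral n) t).
Proof.
elim: n G t => [|n IH] G t; first exact/entails_orIr/le_0.
apply: (@zero_or_succ _ _ t).
  apply: entails_orIl; apply: le_eq (le_0 _ (numeral n.+1)); last exact: pa_refl.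
  by apply: pa_sym; hyp.
rewrite -[shift_form _]/(Or (shift_form (Le t (numeral n.+1))) (shift_form (Le (numeral n.+1) t))).
rewrite !shift_Le shift_numeral.
have eS : Eq (shift_term t) (Succ (Var 0)) :: map shift_form G
    |-- Eq (Succ (Var 0)) (shift_term t) by apply: pa_sym; hyp.
apply: entails_orE (IH _ (Var 0)) _ _.
  apply: entails_orIl; apply: le_eq (entails_weaken _ eS) (pa_refl _ _) _.
  by apply: le_SS; hyp.
apply: entails_orIr; apply: le_eq (pa_refl _ _) (entails_weaken _ eS) _.
by apply: le_SS; hyp.
Qed.

Fixpoint one_of_upto (t : term) (n : nat) : formula :=
  if n is m.+1 then Or (Eq t (numeral n)) (one_of_upto t m) else Eq t Zero.

Lemma subst_one_of_upto s t n :
  subst_form s (one_of_upto t n) = one_of_upto (subst_term s t) n.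
Proof. by elim: n => //= n ->; rewrite subst_numeral. Qed.

Lemma one_of_upto0 G t n : G |-- Eq t Zero -> G |-- one_of_upto t n.
Proof. by move=> e; elim: n => // n IH; apply: entails_orIr. Qed.

Lemma one_of_uptoS G t u n :
  G |-- Eq t (Succ u) -> G |-- one_of_upto u n -> G |-- one_of_upto t n.+1.
Proof.
elim: n G => [|n IH] G e d.
  by apply: entails_orIl; apply: pa_trans e _; apply: pa_congrS.
apply: (entails_orE d).
  by apply: entails_orIl; apply: pa_trans (entails_weaken _ e) _; apply: pa_congrS; hyp.
by apply: entails_orIr; apply: IH; [apply: entails_weaken | hyp].
Qed.

(** Again by induction outside PA: a zero [t] is the last disjunct, and for t = u' the bound on t
    passes to u with the numeral lowered by one. *)
Lemma le_one_of_upto n G t : G |-- Imp (Le t (numeral n)) (one_of_upto t n).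
Proof.
elim: n G t => [|n IH] G t; apply: (@zero_or_succ _ _ t).
- by apply: entails_impI; apply: entails_weaken; hyp.
- rewrite -[shift_form _]/(Imp (shift_form (Le t Zero)) (shift_form (one_of_upto t 0))).
  rewrite shift_Le; apply: entails_impI.
  apply: (@le_elim _ (Succ (Var 0)) Zero); first by apply: le_eq (pa_refl _ _) _; hyp.
  (* With [Var 0] the witness z and [Var 1] the predecessor u, z + u' = 0 would make zero the
     successor of z + u. *)
  apply: (@entails_absurd _ (Eq Zero (Succ (Add (Var 0) (Var 1))))); last exact: pa_succ_neq0.
  by apply: pa_trans (pa_addrS _ _ _); apply: pa_sym; hyp.
- by apply: entails_impI; apply: one_of_upto0; hyp.
- rewrite -[shift_form _]/(Imp (shift_form (Le t (numeral n.+1))) (shift_form (one_of_upto t n.+1))).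
  rewrite shift_Le shift_numeral /shift_form subst_one_of_upto -/shift_term.
  apply: entails_impI; apply: (@one_of_uptoS _ _ (Var 0)); first hyp.
  apply: entails_mp (IH _ _) _; apply: le_SS_inv.
  by apply: le_eq (pa_refl _ _) _; hyp.
Qed.

(** Turns a bound inside PA into a case distinction over actual numbers, by unfolding the finite
    disjunction [one_of_upto]. *)
Lemma le_cases n G t C : G |-- Le t (numeral n) ->
  (forall m, Eq t (numeral m) :: G |-- C) -> G |-- C.
Proof.
move=> /(entails_mp (le_one_of_upto n G t)) d pC.
elim: n G d pC => [|n IH] G d pC; first exact: entails_cut d (pC 0).
apply: (entails_orE d (pC n.+1)); apply: IH; first hyp.
by move=> m; apply: (@entails_mp _ (Eq t (numeral m))); [do 2!apply: entails_weaken; exact: pC | hyp].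
Qed.

(* In each case [G'] is [G] extended with equations that give numeral values to
   the first [k] variables. *)
Lemma le_cases_vars k n G C :
  (forall i, i < k -> G |-- Le (Var i) (numeral n)) ->
  (forall (G' : seq formula) f,
     (forall A, G |-- A -> G' |-- A) ->
     (forall i, i < k -> G' |-- Eq (Var i) (numeral (f i))) -> G' |-- C) ->
  G |-- C.
Proof.
elim: k G C => [|k IH] G C le_k pC; first exact: (pC G id).
apply: (le_cases (le_k k _)) => // m.
apply: IH => [i lt_ik|G' f GG' eqf]; first exact/entails_weaken/le_k/ltnW.
(* [Var k] was split first, with value [m]; [f] holds the values of the variables below [k]. *)
apply: (pC G' (fun i => if i == k then m else f i)) => [A pA|i].
  exact/GG'/entails_weaken.
rewrite ltnS leq_eqVlt; have [->|_] := eqVneq i k; first by move=> _; apply: GG'; hyp.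
exact: eqf.
Qed.

Lemma le_sum_vars k G t i :
  G |-- Le (sum_vars 0 k) t -> i < k.+1 -> G |-- Le (Var i) t.
Proof.
elim: k i => [|k IH] i; first by case: i.
rewrite sum_varsS => l; rewrite ltnS leq_eqVlt => /predU1P[->|lt_ik].
  exact: le_addr l.
exact: IH (le_addl l) lt_ik.
Qed.

(** * Evaluation of terms at numerals in PA *)

Lemma numeralD G m n : G |-- Eq (Add (numeral m) (numeral n)) (numeral (m + n)).
Proof.
elim: n => [|n IH]; first by rewrite addn0; apply: pa_addr0.
by rewrite addnS; apply: pa_trans (pa_addrS _ _ _) _; apply: pa_congrS.
Qed.

Lemma numeralM G m n : G |-- Eq (Mul (numeral m) (numeral n)) (numeral (m * n)).
Proof.
elim: n => [|n IH]; first by rewrite muln0; apply: pa_mulr0.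
rewrite mulnS addnC; apply: pa_trans (pa_mulrS _ _ _) _.
exact: pa_trans (pa_congrD IH (pa_refl _ _)) (numeralD _ _ _).
Qed.

Lemma numeral_neq G m n : m != n -> G |-- Neg (Eq (numeral m) (numeral n)).
Proof.
elim: m n => [|m IH] [|n] //; first by move=> _; apply: pa_succ_neq0.
  move=> _; apply: (@entails_negI _ _ (Eq Zero (Succ (numeral m)))); last exact: pa_succ_neq0.
  by apply: pa_sym; hyp.
rewrite eqSS => /IH pN; apply: (@entails_negI _ _ (Eq (numeral m) (numeral n))).
  by apply: pa_succ_inj; hyp.
exact: entails_weaken.
Qed.

Fixpoint teval (f : nat -> nat) (t : term) : nat :=
  match t with
  | Var n => f n
  | Zero => 0
  | Succ t1 => (teval f t1).+1
  | Add t1 t2 => teval f t1 + teval f t2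
  | Mul t1 t2 => teval f t1 * teval f t2
  end.

(** PA computes sums and products of numerals, hence all terms. Since [s i] need only be provably
    equal to a numeral, this covers both substituted numerals and variables fixed by case
    hypotheses. *)
Lemma teval_provable G s f k t :
  (forall i, i < k -> G |-- Eq (s i) (numeral (f i))) -> term_below k t ->
  G |-- Eq (subst_term s t) (numeral (teval f t)).
Proof.
move=> sf; elim: t => /= [i|_|t IH|t1 IH1 t2 IH2|t1 IH1 t2 IH2].
- exact: sf.
- exact: pa_refl.
- by move=> /IH; apply: pa_congrS.
- by case/andP=> /IH1 e1 /IH2 e2; apply: pa_trans (pa_congrD e1 e2) (numeralD _ _ _).
- by case/andP=> /IH1 e1 /IH2 e2; apply: pa_trans (pa_congrM e1 e2) (numeralM _ _ _).
Qed.

(** * Polynomials and their representational formulas *)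

(** A variant of [zero_at] with valuations on all of nat, so that one valuation serves polynomials
    of different arities and blocks are read off by offset. *)
Definition vanishes n (D : {mpoly int[n]}) (f : nat -> nat) : Prop :=
  (D.@[fun i : 'I_n => (f i)%:Z] = 0)%R.

Lemma teval_numeral f n : teval f (numeral n) = n.
Proof. by elim: n => //= n ->. Qed.

Lemma teval_pow f t k : teval f (pow_term t k) = teval f t ^ k.
Proof.
case: k => // k; rewrite /pow_term; elim: k => [|k IH]; first by rewrite expn1.
by rewrite iterS /= IH [in RHS]expnSr.
Qed.

Lemma meval_nexp n (e : nexp n) (f : nat -> nat) :
  ((nexp_poly e).@[fun i : 'I_n => (f i)%:Z] = (teval f (nexp_term e))%:Z)%R.
Proof.
elim: e => [i|c|e1 IH1 e2 IH2|e1 IH1 e2 IH2|e IH k] /=.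
- by rewrite mevalXU.
- by rewrite rmorph_nat teval_numeral natz.
- by rewrite mevalD IH1 IH2 PoszD.
- by rewrite mevalM IH1 IH2 PoszM.
- by rewrite rmorphXn /= IH teval_pow -!natz natrX.
Qed.

Lemma numeral_below k n : term_below k (numeral n).
Proof. by elim: n. Qed.

Lemma nexp_term_below n (e : nexp n) : term_below n (nexp_term e).
Proof.
elim: e => [i|c|e1 IH1 e2 IH2|e1 IH1 e2 IH2|e IH k] /=; rewrite ?IH1 ?IH2 //.
  exact: numeral_below.
by case: k => // k; elim: k => //= k ->.
Qed.

Section Representational.

Variables (n : nat) (D : {mpoly int[n]}) (d : formula).
Hypothesis hD : representational D d.
Variables (G : seq formula) (s : nat -> term) (f : nat -> nat).
Hypothesis sf : forall i, i < n -> G |-- Eq (s i) (numeral (f i)).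

(** At a zero of [D] both sides of the equation evaluate to the same numeral. *)
Lemma representational_true : vanishes D f -> G |-- subst_form s d.
Proof.
have [L [R [-> ->]]] := hD; rewrite /vanishes mevalB !meval_nexp => /eqP.
rewrite subr_eq0 => /eqP [eLR] /=.
apply: pa_trans (teval_provable sf (nexp_term_below L)) _; rewrite eLR.
exact: pa_sym (teval_provable sf (nexp_term_below R)).
Qed.

(** Away from the zeros the two sides evaluate to distinct numerals, which PA proves unequal. *)
Lemma representational_false : ~ vanishes D f -> G |-- Neg (subst_form s d).
Proof.
have [L [R [-> ->]]] := hD; rewrite /vanishes mevalB !meval_nexp => /eqP.
rewrite subr_eq0 eqz_nat => /(numeral_neq G) nLR /=.
apply: entails_negI (entails_weaken _ nLR).
apply: pa_trans (entails_weaken _ (teval_provable sf (nexp_term_below R))).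
by apply: pa_trans (pa_sym (entails_weaken _ (teval_provable sf (nexp_term_below L)))) _; hyp.
Qed.

End Representational.

Lemma nth_xvars n o k j : j < k -> (nth 0 (xvars n o k) j = 'X_(inord (o + j)))%R.
Proof. by move=> lt_jk; rewrite -(tnth_nth _ _ (Ordinal lt_jk)) tnth_mktuple. Qed.

Lemma meval_inord n m (f : nat -> nat) : m <= n ->
  (('X_(inord m) : {mpoly int[n.+1]}).@[fun i : 'I_n.+1 => (f i)%:Z] = (f m)%:Z)%R.
Proof. by move=> le_mn; rewrite mevalXU inordK. Qed.

(** Composition with variables only selects arguments; the bounds on [p] and [o + k] keep every
    [inord] index faithful. *)
Lemma vanishes_comp1 n k o p (D : {mpoly int[k.+1]}) f (w : k.-tuple nat) :
  p <= n -> o + k <= n.+1 -> (forall j, j < k -> nth 0 w j = f (o + j)) ->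
  vanishes (D \mPo [tuple of 'X_(inord p) :: xvars n o k]) f <->
  zero_at D [tuple of f p :: w].
Proof.
move=> le_pn le_on ew; rewrite /vanishes /zero_at comp_mpoly_meval.
suff -> : (D.@[fun i => (tnth [tuple of 'X_(inord p) :: xvars n o k] i).@[
              fun i : 'I_n.+1 => (f i)%:Z]] =
           D.@[fun i => (tnth [tuple of f p :: w] i)%:Z])%R by [].
apply: meval_eq => -[[|i] lt_ik]; rewrite (tnth_nth 0%R) (tnth_nth 0) /=.
  exact: meval_inord.
by rewrite nth_xvars // meval_inord ?ew //; lia.
Qed.

Lemma vanishes_comp2 n k o p q (D : {mpoly int[k.+2]}) f (w : k.-tuple nat) :
  p <= n -> q <= n -> o + k <= n.+1 -> (forall j, j < k -> nth 0 w j = f (o + j)) ->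
  vanishes (D \mPo [tuple of 'X_(inord p) :: 'X_(inord q) :: xvars n o k]) f <->
  zero_at D [tuple of f p :: f q :: w].
Proof.
move=> le_pn le_qn le_on ew; rewrite /vanishes /zero_at comp_mpoly_meval.
suff -> : (D.@[fun i => (tnth [tuple of 'X_(inord p) :: 'X_(inord q) :: xvars n o k] i).@[
              fun i : 'I_n.+1 => (f i)%:Z]] =
           D.@[fun i => (tnth [tuple of f p :: f q :: w] i)%:Z])%R by [].
apply: meval_eq => -[[|[|i]] lt_ik]; rewrite (tnth_nth 0%R) (tnth_nth 0) /=.
- exact: meval_inord.
- exact: meval_inord.
- by rewrite nth_xvars // meval_inord ?ew //; lia.
Qed.

(** Squares of integers are nonnegative, so a sum of squares encodes a conjunction. *)
Lemma vanishes_sqrD n (D1 D2 : {mpoly int[n]}) f :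
  vanishes (D1 ^+ 2 + D2 ^+ 2)%R f <-> vanishes D1 f /\ vanishes D2 f.
Proof.
rewrite /vanishes mevalD !rmorphXn /=; split=> [/eqP|[-> ->]]; last by rewrite expr0n.
by rewrite paddr_eq0 ?sqr_ge0 // !sqrf_eq0 => /andP[/eqP-> /eqP->].
Qed.

Lemma vanishes_sqrD3 n (D1 D2 D3 : {mpoly int[n]}) f :
  vanishes (D1 ^+ 2 + D2 ^+ 2 + D3 ^+ 2)%R f <->
  [/\ vanishes D1 f, vanishes D2 f & vanishes D3 f].
Proof.
rewrite /vanishes !mevalD !rmorphXn /=; split=> [/eqP|[-> -> ->]]; last by rewrite expr0n.
rewrite paddr_eq0 ?addr_ge0 ?sqr_ge0 // paddr_eq0 ?sqr_ge0 // !sqrf_eq0.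
by case/andP=> /andP[/eqP-> /eqP->] /eqP->.
Qed.

(** * Zeros of D_U and D_V as proofs of R and of its negation *)

Section ProofPolynomials.

Variables (nw nw1 nw3 : nat).
Variables (D_PE : {mpoly int[nw.+2]}) (D_FC : {mpoly int[nw1.+1]}).
Variable (D_Neg : {mpoly int[nw3.+2]}).
Hypotheses (h_PE : expresses_proof D_PE) (h_FC : expresses_formula_code D_FC).
Hypothesis h_Neg : expresses_negation D_Neg.
Variable R : formula.

Lemma nth_block o k (f : nat -> nat) j :
  j < k -> nth 0 [tuple f (o + i) | i < k] j = f (o + j).
Proof. by move=> lt_jk; rewrite -(tnth_nth _ _ (Ordinal lt_jk)) tnth_mktuple. Qed.

(** The square of [D_PE] says that [f 1] codes a proof of the formula with code [f 0]. *)
Lemma vanishes_D_U f : vanishes (D_U D_FC D_PE) f -> f 0 = code_form R -> provable R.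
Proof.
case/vanishes_sqrD=> _.
have le_len : 2 + nw1 + nw <= (len_u nw nw1).+2 by rewrite /len_u; lia.
move=> /(vanishes_comp2 D_PE _ _ _ (@nth_block (2 + nw1) nw f)).1.
move=> /(_ isT isT le_len) zPE f0; rewrite f0 in zPE.
by have [|p [pR _]] := (h_PE R (f 1)).2; [eexists; exact: zPE | exists p].
Qed.

Lemma D_U_vanishes :
  provable R -> exists f, f 0 = code_form R /\ vanishes (D_U D_FC D_PE) f.
Proof.
case=> p pR.
have [w1 z1] := (h_FC (code_form R)).2 (ex_intro _ R erefl).
have [w z] := (h_PE R (code_proof p)).1 (ex_intro _ p (conj pR erefl)).
(* The list follows the variable order a, b, x_w1, x_w of [D_U]; past its end the valuation is 0. *)
pose f := nth 0 (code_form R :: code_proof p :: w1 ++ w); exists f; split=> //.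
have le1 : 2 + nw1 <= (len_u nw nw1).+2 by rewrite /len_u; lia.
have le2 : 2 + nw1 + nw <= (len_u nw nw1).+2 by rewrite /len_u; lia.
apply/vanishes_sqrD; split.
  apply: (vanishes_comp1 D_FC (o := 2) (p := 0) (f := f) (w := w1) isT le1 _).2 => // j lt_j.
  by rewrite /f /= nth_cat size_tuple lt_j.
apply: (vanishes_comp2 D_PE (n := (len_u nw nw1).+1) (o := 2 + nw1) (p := 0) (q := 1) (f := f) (w := w) isT isT le2 _).2 => // j lt_j.
by rewrite /f /= nth_cat size_tuple ltnNge leq_addr /= addKn.
Qed.

Lemma vanishes_D_V f :
  vanishes (D_V D_FC D_Neg D_PE) f -> f 0 = code_form R -> provable (Neg R).
Proof.
case/vanishes_sqrD3=> _.
have le0 : 2 + nw1 <= (len_v nw nw1 nw3).+1 by rewrite /len_v; lia.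
have le1 : 3 + nw1 + nw3 <= (len_v nw nw1 nw3).+2 by rewrite /len_v; lia.
have le2 : 3 + nw1 + nw3 + nw <= (len_v nw nw1 nw3).+2 by rewrite /len_v; lia.
move=> /(vanishes_comp2 D_Neg _ _ _ (@nth_block (3 + nw1) nw3 f)).1.
move=> /(_ isT le0 le1) zNeg.
move=> /(vanishes_comp2 D_PE _ _ _ (@nth_block (3 + nw1 + nw3) nw f)).1.
move=> /(_ le0 isT le2) zPE f0; rewrite f0 in zNeg.
have [|A [eA eNA]] := (h_Neg (code_form R) (f (2 + nw1))).1; first by eexists; exact: zNeg.
(* The code of [Neg A] is computed from the code of [A] alone, so it is the code of [Neg R] as soon
   as [A] and [R] share a code. *)
have eNR : f (2 + nw1) = code_form (Neg R) by rewrite eNA /= eA.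
rewrite eNR in zPE.
by have [|p [pR _]] := (h_PE (Neg R) (f 1)).2; [eexists; exact: zPE | exists p].
Qed.

Lemma D_V_vanishes : provable (Neg R) ->
  exists f, f 0 = code_form R /\ vanishes (D_V D_FC D_Neg D_PE) f.
Proof.
case=> p pR.
have [w1 z1] := (h_FC (code_form R)).2 (ex_intro _ R erefl).
have [w3 z3] := (h_Neg (code_form R) (code_form (Neg R))).2
  (ex_intro _ R (conj erefl erefl)).
have [w z] := (h_PE (Neg R) (code_proof p)).1 (ex_intro _ p (conj pR erefl)).
(* In the order of [D_V], x_0 stands between x_w1 and x_w3, at index 2 + nw1; its value is the code
   of [Neg R]. *)
pose f := nth 0 (code_form R :: code_proof p :: w1 ++ code_form (Neg R) :: w3 ++ w).
have f1 j : j < nw1 -> f (2 + j) = nth 0 w1 j.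
  by move=> lt_j; rewrite /f /= nth_cat size_tuple lt_j.
have f2 j : f (2 + nw1 + j) = nth 0 (code_form (Neg R) :: w3 ++ w) j.
  by rewrite /f /= nth_cat size_tuple ltnNge leq_addr /= addKn.
have f0 : f (2 + nw1) = code_form (Neg R) by rewrite -[_ + _]addn0 f2.
have le1 : 2 + nw1 <= (len_v nw nw1 nw3).+1 by rewrite /len_v; lia.
have le2 : 3 + nw1 + nw3 <= (len_v nw nw1 nw3).+2 by rewrite /len_v; lia.
have le3 : 3 + nw1 + nw3 + nw <= (len_v nw nw1 nw3).+2 by rewrite /len_v; lia.
exists f; split=> //; apply/vanishes_sqrD3; split.
- by apply: (vanishes_comp1 D_FC (o := 2) (p := 0) (f := f) (w := w1) isT (leqW le1) _).2 => // j /f1.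
- apply: (vanishes_comp2 D_Neg (n := (len_v nw nw1 nw3).+1) (o := 3 + nw1) (p := 0) (q := 2 + nw1) (f := f) (w := w3) isT le1 le2 _).2; last by rewrite f0.
  (* The offset 3 + nw1 is one step past x_0, from which [f2] counts. *)
  move=> j lt_j; rewrite -[3 + nw1 + j]/((2 + nw1 + j).+1) -addnS f2 /=.
  by rewrite nth_cat size_tuple lt_j.
- apply: (vanishes_comp2 D_PE (n := (len_v nw nw1 nw3).+1) (o := 3 + nw1 + nw3) (p := 2 + nw1) (q := 1) (f := f) (w := w) le1 isT le3 _).2; last by rewrite f0.
  move=> j lt_j; rewrite -[3 + nw1 + nw3 + j]/((2 + nw1 + nw3 + j).+1).
  by rewrite -addnA -addnS f2 /= nth_cat size_tuple ltnNge leq_addr /= addKn.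
Qed.

End ProofPolynomials.

(** * Rosser's argument *)

Definition numerals (f : nat -> nat) (k : nat) : seq term := mkseq (numeral \o f) k.

Section Rosser.

Variables (nu nv : nat) (D1 : {mpoly int[nu.+2]}) (D2 : {mpoly int[nv.+2]}).
Variables (d1 d2 : formula) (c : nat).
Hypotheses (h1 : representational D1 d1) (h2 : representational D2 d2).

Let body := rosser_body nu nv d1 d2 (numeral c).

(** The contradictory formula is the existential conclusion of [body], instantiated at the numerals
    of the solution [f]. *)
Lemma rosser_body_refutable f :
  vanishes D1 f -> f 0 = c -> (forall g, vanishes D2 g -> g 0 <> c) ->
  provable body -> exists A, provable A /\ provable (Neg A).
Proof.
move=> z1 f0 z2 pB.
(* [inst] has removed the parameter, so [Var i] of the body is variable [i.+1] of [D1]. *)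
pose x i := f i.+1; pose ts := numerals x nu.+1.
have xE i : i < nu.+1 -> msubst ts i = numeral (x i).
  by move=> lt_i; rewrite msubst_lt ?size_mkseq // nth_mkseq.
pose C := Exs nv.+1
  (And (Le (sum_vars 0 nv) (sum_vars nv.+1 nu)) (inst d2 (numeral c))).
pose E := subst_form (msubst ts) C.
have pE : [::] |-- Imp (subst_form (msubst ts) (inst d1 (numeral c))) E.
  by apply: (@entails_allsE [::] ts (Imp _ C)); rewrite size_mkseq.
exists E.
have {}pE : [::] |-- E.
  apply: (entails_mp pE); rewrite instE subst_formA.
  apply: (representational_true h1 _ z1) => -[|i] lt_i.
    by rewrite /= subst_numeral f0; apply: pa_refl.
  by rewrite -[subst_term _ _]/(msubst ts i) xE //; apply: pa_refl.
(* To refute [E], the existential variables are left free and the matrix is refuted. *)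
split=> //; rewrite /E /C subst_Exs; apply: provable_neg_exs.
rewrite -/(entails [::] _).
pose N := teval x (sum_vars 0 nu).
set s := iter _ up _; rewrite -[subst_form s _]/(And (subst_form s (Le _ _)) (subst_form s _)).
set L := subst_form s _; set V := subst_form s _.
suff pV : [:: And L V] |-- Neg V.
  by apply: entails_negI pV; apply: (@entails_andEr _ L); hyp.
have pL : [:: And L V] |-- Le (sum_vars 0 nv) (numeral N).
  (* Under the existential block [s] fixes the variables below [nv.+1] and sends the next ones to
     the numerals of [x], whose sum is [N]. *)
  apply: (@le_eq _ (subst_term s (sum_vars 0 nv)) _ (subst_term s (sum_vars nv.+1 nu))).
  - rewrite (@subst_term_below nv.+1) ?sum_vars_below // => [|i lt_i]; first exact: pa_refl.
    exact: iter_up_lt.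
  - rewrite subst_sum_vars; apply: teval_provable (sum_vars_below nu) => i lt_i.
    rewrite /s iter_up_ge xE //.
    by rewrite iter_shift_numeral; apply: pa_refl.
  - by rewrite -subst_Le; apply: (@entails_andEl _ _ V); hyp.
apply: (@le_cases_vars nv.+1 N _ _ (fun i lt_i => le_sum_vars pL lt_i)) => G g _ eqg.
rewrite /V instE subst_formA.
(* The values of a case, with the parameter put back in front, form a valuation that cannot be a
   zero of [D2]. *)
pose g' i := if i is j.+1 then g j else c.
apply: (representational_false h2 (f := g')); last by move=> /z2.
case=> [|i] lt_i; first by rewrite /= subst_numeral; apply: pa_refl.
by rewrite /= /s iter_up_lt //; apply: eqg.
Qed.

Lemma rosser_body_provable g :
  vanishes D2 g -> g 0 = c -> (forall f, vanishes D1 f -> f 0 <> c) -> provable body.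
Proof.
(* The universal block comes from generalization, so its variables are free in what follows. *)
move=> z2 g0 z1; apply: provable_alls; rewrite -/(entails [::] _).
pose y i := g i.+1; pose ts := numerals y nv.+1.
have yE i : i < nv.+1 -> msubst ts i = numeral (y i).
  by move=> lt_i; rewrite msubst_lt ?size_mkseq // nth_mkseq.
pose M := teval y (sum_vars 0 nv).
(* Below [M] the premise [d1] is refuted case by case; above [M] the numerals of [y], whose sum is
   [M], are witnesses. *)
apply: entails_impI; apply: (entails_orE (le_total_numeral M _ (sum_vars 0 nu))).
  set G := [:: _; _]; apply: (@entails_absurd _ (inst d1 (numeral c))); first by rewrite /G; hyp.
  have lM : G |-- Le (sum_vars 0 nu) (numeral M) by rewrite /G; hyp.
  apply: (@le_cases_vars nu.+1 M _ _ (fun i lt_i => le_sum_vars lM lt_i)) => G' f _ eqf.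
  pose f' i := if i is j.+1 then f j else c.
  apply: (representational_false h1 (f := f')); last by move=> /z1.
  by case=> [|i] lt_i; [apply: pa_refl | apply: eqf].
have {1}-> : nv.+1 = size ts by rewrite size_mkseq.
apply: entails_exsI.
rewrite -[subst_form _ _]/(And (subst_form _ (Le _ _)) (subst_form _ _)).
apply: entails_andI.
  rewrite subst_Le; apply: (@le_eq _ (numeral M) _ (sum_vars 0 nu)); last hyp.
    apply: pa_sym; apply: teval_provable (sum_vars_below nv) => i lt_i.
    by rewrite yE //; apply: pa_refl.
  (* Filling the [nv.+1] existential variables lowers the universal block back to offset 0. *)
  rewrite subst_sum_vars -[X in Eq X _]subst_term_Var.
  rewrite (_ : subst_term _ _ = subst_term Var (sum_vars 0 nu)); first exact: pa_refl.
  by apply: eq_subst_term => i; rewrite -(msubst_ge ts) size_mkseq.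
rewrite instE subst_formA; apply: (representational_true h2 _ z2) => -[|i] lt_i.
  by rewrite /= subst_numeral g0; apply: pa_refl.
by rewrite -[subst_term _ _]/(msubst ts i) yE //; apply: pa_refl.
Qed.

End Rosser.

Theorem theorem4 (nw nw1 nw3 : nat)
    (D_PE : {mpoly int[nw.+2]})
    (D_FC : {mpoly int[nw1.+1]})
    (D_Neg : {mpoly int[nw3.+2]})
    (h_PE : expresses_proof D_PE)
    (h_FC : expresses_formula_code D_FC)
    (h_Neg : expresses_negation D_Neg)
    (d_U d_V : formula)
    (h_U : representational (D_U D_FC D_PE) d_U)
    (h_V : representational (D_V D_FC D_Neg D_PE) d_V)
    (R : formula)
    (sentence_R : sentence R)
    (h_R : provable
       (Iff R (rosser_body (len_u nw nw1) (len_v nw nw1 nw3) d_U d_V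
                 (numeral (code_form R)))))
    (consistent : PA_consistent) :
  ~ provable R /\ ~ provable (Neg R).
Proof.
split=> pR; apply: (consistent).
  have [f [f0 zf]] := D_U_vanishes h_PE h_FC pR.
  apply: (rosser_body_refutable h_U h_V zf f0).
    (* A zero of [D_V] at the code of [R] would give a proof of [Neg R] beside that of [R]. *)
    move=> g zg g0; apply: consistent; exists R; split=> //.
    exact: vanishes_D_V h_PE h_Neg _ _ zg g0.
  exact: provable_mp (@entails_andEl [::] _ _ h_R) pR.
have [g [g0 zg]] := D_V_vanishes h_PE h_FC h_Neg pR.
(* The converse half of the fixed point turns a proof of the body into a proof of [R]. *)
exists R; split=> //; apply: provable_mp (@entails_andEr [::] _ _ h_R) _.
apply: (rosser_body_provable h_U h_V zg g0) => f zf f0.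
apply: consistent; exists R; split=> //.
exact: vanishes_D_U h_PE _ _ zf f0.
Qed.
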